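(* Let $\kappa\in\mathbb R$ and let $\mathcal E^\infty$ be the infinite prolongation of the equation $$u_{yy}=u_{tx}+\left(\tfrac12(\kappa+1)u_x^2+u_y\right)u_{xx}+\kappa\,u_x\,u_{xy}.$$ With fibre variables $v_j$, $j\in\mathbb N\cup\{0\}$, put $$\widetilde D_x=\bar D_x+\sum_{j\ge0}v_{j+1}\frac{\partial}{\partial v_j},\qquad \widetilde D_t=\bar D_t+\sum_{j\ge0}\widetilde D_x^{\,j}(T)\frac{\partial}{\partial v_j},\qquad \widetilde D_y=\bar D_y+\sum_{j\ge0}\widetilde D_x^{\,j}(S)\frac{\partial}{\partial v_j}.$$ Then $\widetilde D_t,\widetilde D_x,\widetilde D_y$ define an infinite-dimensional covering of the equation in each of the following cases: 1) $\kappa\neq-1$: $T=\big(\frac12(\kappa+1)u_x^2-u_y\big)v_1$, $S=-u_xv_1$; 2) $\kappa\notin\{-2,-\frac32,-1\}$: $T=(2\kappa+3)^{-1}v_1^{2\kappa+3}-u_xv_1^{\kappa+2}+\big(\frac12(\kappa+1)u_x^2-u_y\big)v_1$, $S=(\kappa+2)^{-1}v_1^{\kappa+2}-u_xv_1$; 3) $\kappa=-2$: $T=-\big(v_1^{-1}+u_x+(\frac12u_x^2+u_y)v_1\big)$, $S=\ln|v_1|-u_xv_1$; 4) $\kappa=-\frac32$: $T=-\big((\frac14u_x^2+u_y)v_1+u_x\sqrt{|v_1|}-\ln|v_1|\big)$, $S=2\sqrt{|v_1|}-u_xv_1$; 5) $\kappa=-3$: $T=-\big(u+(u_x^2+u_y)v_1\big)$,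 $S=-(v_1u_x+x)$; 6) $\kappa=-1$, $\lambda\in\mathbb R$: $T=-(u_y+\lambda u_x-\lambda^2)v_1$, $S=-(u_x-\lambda)v_1$.
   Context: Coordinates on the infinite jet bundle of functions $u(t,x,y)$ are $t,x,y$ and $u_I$, $I$ a symmetric multi-index in $t,x,y$ ($u_\emptyset=u$). Total derivatives are $D_i=\partial/\partial x^i+\sum_I u_{Ii}\,\partial/\partial u_I$, where $x^i$ runs over $t,x,y$. For an equation $F=0$, $\mathcal E^\infty=\{D_I(F)=0\ \text{for all }I\}$, where $D_I$ is the composition of the $D_i$ with indices in $I$, and $\bar D_i$ is the restriction of $D_i$ to $\mathcal E^\infty$. A covering over $\mathcal E^\infty$ is a bundle $\mathcal E^\infty\times\mathcal V\to\mathcal E^\infty$ with fibre coordinates $v^\alpha$ (finitely or countably many), equipped with extended total derivatives $\widetilde D_i=\bar D_i+\sum_\alpha T^\alpha_i(x^j,u_I,v^\beta)\,\partial/\partial v^\alpha$ satisfying $[\widetilde D_i,\widetilde D_j]=0$ whenever $(x^i,u_I)\in\mathcal E^\infty$. Everything is local, where the displayed expressions are defined. $\widetilde D_x^{\,j}$ denotes the $j$-fold iterate of $\widetilde D_x$.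
   Formalization: Case 4 (κ = −3/2) is proved only for v_1 > 0: for v_1 < 0 the displayed T and S do not give a covering, since there D̃_t(S) − D̃_y(T) = 2u_xx on the equation, which is not identically zero. *)

(* Defs.v *)
From HB Require Import structures.
From mathcomp Require Import all_boot all_order all_algebra.
From mathcomp Require Import all_classical all_reals all_analysis.

Set Implicit Arguments.
Unset Strict Implicit.
Unset Printing Implicit Defensive.

Import Order.TTheory GRing.Theory Num.Theory.
Import numFieldNormedType.Exports.

Local Open Scope classical_set_scope.
Local Open Scope ring_scope.

(* The independent variables t, x, y. *)
Inductive dir := dt | dx | dy.

(* Coordinates on J^oo x V: the independent variables, the jet coordinates
   [jet a b c] = u_I with I = t^a x^b y^c (so [jet 0 0 0] is u), and the fibre
   coordinates v_j.  Functions on J^oo (resp. J^oo x V) are functions of points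
   of the product; those coming from J^oo do not involve the v_j. *)
Inductive coord := base of dir | jet of nat & nat & nat | fibre of nat.

HB.instance Definition _ := gen_eqMixin coord.
HB.instance Definition _ := gen_choiceMixin coord.

Section Coverings.
Context {R : realType}.

Definition jetpt := {ptws coord -> R}.

Implicit Types (f g : jetpt -> R) (p q : jetpt) (Omega E : set jetpt).

Definition coordf (c : coord) : jetpt -> R := fun p => p c.

Definition along (c : coord) f p : R -> R :=
  fun s => f (fun d => if d == c then s else p d).

Definition partial (c : coord) f : jetpt -> R :=
  fun p => derive1 (along c f p) (p c).

(* Smooth functions of finitely many coordinates on the open set Omega. *)
Definition finite_order Omega f :=
  exists A : seq coord, forall p q, Omega p -> Omega q ->
    {in A, forall c, p c = q c} -> f p = f q.

Definition smooth Omega f :=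
  finite_order Omega f /\
  forall (s : seq coord) p, Omega p ->
    {for p, continuous (foldr partial f s)} /\
    forall c, derivable (along c (foldr partial f s) p) (p c) 1.

(* [X] stands for the formal vector field \sum_c X_c d/dc.  On a function of
   finitely many coordinates only finitely many summands are nonzero. *)
Definition vfield := coord -> jetpt -> R.

Definition act (X : vfield) f : jetpt -> R :=
  fun p => \sum_(c \in [set: coord]) X c p * partial c f p.

(* The index I i. *)
Definition jet_succ (i : dir) (a b c : nat) : coord :=
  match i with
  | dt => jet a.+1 b c
  | dx => jet a b.+1 c
  | dy => jet a b c.+1
  end.

(* The extension D_i + \sum_j T_j d/dv_j of the total derivative D_i. *)
Definition extD (i : dir) (T : nat -> jetpt -> R) : vfield := fun c p =>
  match c with
  | base k => match i, k with
              | dt, dt | dx, dx | dy, dy => 1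
              | _, _ => 0
              end
  | jet a b c => p (jet_succ i a b c)
  | fibre j => T j p
  end.

Definition totalD (i : dir) : vfield := extD i (fun _ _ => 0).

(* E^oo x V, where E^oo is the infinite prolongation of F = 0. *)
Definition prolongation (F : jetpt -> R) : set jetpt :=
  [set p | forall I : seq dir, foldr (fun i => act (totalD i)) F I p = 0].

(* The fields D_i + \sum_j T_i^j d/dv_j define a covering, with fibre
   coordinates v_0, v_1, ..., over the part E `&` Omega of E: their coefficients
   are smooth and they commute, as operators on smooth functions, at the points
   lying over E.  The D_i are tangent to an infinite prolongation E, so applying
   the fields on the ambient space and then restricting to E is the same as
   applying the restricted fields. *)
Definition is_covering Omega E (T : dir -> nat -> jetpt -> R) :=
  [/\ open Omega,
      forall i j, smooth Omega (T i j)
    & forall i k f, smooth Omega f -> forall p, Omega p -> E p ->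
        act (extD i (T i)) (act (extD k (T k)) f) p =
        act (extD k (T k)) (act (extD i (T i)) f) p].

(* D~_x(v_j) = v_{j+1}, D~_t(v_j) = D~_x^j(T), D~_y(v_j) = D~_x^j(S). *)
Definition shift_coef (j : nat) : jetpt -> R := coordf (fibre j.+1).

Definition tower (T S : jetpt -> R) (i : dir) (j : nat) : jetpt -> R :=
  match i with
  | dx => shift_coef j
  | dt => iter j (act (extD dx shift_coef)) T
  | dy => iter j (act (extD dx shift_coef)) S
  end.

Definition x_ := coordf (base dx).
Definition u := coordf (jet 0 0 0).
Definition u_x := coordf (jet 0 1 0).
Definition u_y := coordf (jet 0 0 1).
Definition u_tx := coordf (jet 1 1 0).
Definition u_xx := coordf (jet 0 2 0).
Definition u_xy := coordf (jet 0 1 1).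
Definition u_yy := coordf (jet 0 0 2).
Definition v_1 := coordf (fibre 1).

Definition equation (kappa : R) : jetpt -> R := fun p =>
  u_yy p - (u_tx p + (2^-1 * (kappa + 1) * u_x p ^+ 2 + u_y p) * u_xx p
            + kappa * u_x p * u_xy p).

(* Real powers: a ^ r for an integer r is the algebraic power, also for a < 0
   (where [powR] has a junk value); the two agree for a > 0.  [rpow_dom r] is
   the set where a |-> a ^ r is defined (and smooth). *)
Definition rpow (a r : R) : R :=
  if r \is a Num.int then a ^ Num.floor r else a `^ r.

Definition rpow_dom (r : R) : set R :=
  [set a | 0 < a \/ (r \is a Num.int /\ (a != 0 \/ 0 <= r))].

End Coverings.

Arguments jetpt R : clear implicits.

(* Main.v *)
Require Import Defs.
From HB Require Import structures.
From mathcomp Require Import all_boot all_order all_algebra.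
From mathcomp Require Import all_classical all_reals all_analysis.
From mathcomp Require Import ring lra zify.

(** D~_x commutes with D~_t and D~_y everywhere, by the shape of the tower.
    Hence [D~_t, D~_y] v_j = D~_x^j (D~_t S - D~_y T), and in each of the six
    cases D~_t S - D~_y T = v_1 F, where F = 0 is the equation.  By the Leibniz
    rule D~_x^j (v_1 F) is a combination of the functions D_x^k F, which vanish
    on the infinite prolongation. *)

Set Implicit Arguments.
Unset Strict Implicit.
Unset Printing Implicit Defensive.

Import Order.TTheory GRing.Theory Num.Theory.
Import numFieldNormedType.Exports.

Local Open Scope classical_set_scope.
Local Open Scope ring_scope.

Local Notation coord := Defs.coord.

(** * Smooth functions *)

Section SmoothFunctions.
Context {R : realType}.
Implicit Types (f g : jetpt R -> R) (p q : jetpt R) (Omega : set (jetpt R)).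
Implicit Types (c d : coord) (A B : seq coord).

(** The identity D~_t S - D~_y T = v_1 F is established at every point of the open domain, not only
    over the equation. This is what permits applying D~_x^j to it: equality on the prolongation
    alone says nothing about derivatives taken in the ambient jet space. The v_2 terms cancel by
    themselves, since both D~_t S and D~_y T contain (dS/dv_1)(dT/dv_1) v_2. Passing from
    coordinates to arbitrary smooth functions requires the second-order part of a commutator to
    vanish, that is, symmetry of mixed partial derivatives on an infinite product. Only two
    coordinates move at a time, so the classical argument with second differences on a small square
    applies. *)

Definition upd p c (s : R) : jetpt R := fun d => if d == c then s else p d.

Lemma upd_same p c s : upd p c s c = s.
Proof. by rewrite /upd eqxx. Qed.

Lemma upd_other p c d s : d != c -> upd p c s d = p d.
Proof. by rewrite /upd => /negPf ->. Qed.

Lemma upd_id p c : upd p c (p c) = p.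
Proof. by apply/funext => d; rewrite /upd; case: eqP => [->|]. Qed.

Lemma upd_upd p c s t : upd (upd p c s) c t = upd p c t.
Proof. by apply/funext => d; rewrite /upd; case: eqP. Qed.

Lemma updC p c d s t : c != d -> upd (upd p c s) d t = upd (upd p d t) c s.
Proof.
move=> cd; apply/funext => e; rewrite /upd.
by case: (eqVneq e d) => // ->; rewrite eq_sym (negPf cd).
Qed.

Lemma alongE c f p : along c f p = fun s => f (upd p c s).
Proof. by []. Qed.

Lemma along_upd c f p s : along c f (upd p c s) = along c f p.
Proof. by apply/funext => t; rewrite !alongE upd_upd. Qed.

Lemma cvg_jetpt (T : Type) (F : set_system T) (h : T -> jetpt R) p : Filter F ->
  (forall c, h x c @[x --> F] --> p c) -> h @ F --> p.
Proof.
move=> FF hp.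
by apply/(@pointwise_cvgP (discrete_topology coord) R (h @ F) p) => c; exact: hp.
Qed.

Lemma upd2_continuous p c d (a b : R) :
  {for (a, b), continuous (fun st : R * R => upd (upd p c st.1) d st.2)}.
Proof.
apply: cvg_jetpt => e; rewrite /upd.
case: (e == d); first exact: cvg_snd.
by case: (e == c); [exact: cvg_fst|exact: cvg_cst].
Qed.

Lemma upd_continuous p c (a : R) : {for a, continuous (upd p c)}.
Proof.
apply: cvg_jetpt => e; rewrite /upd.
by case: (e == c); [exact: cvg_id|exact: cvg_cst].
Qed.

Lemma coordf_continuous c : continuous (@coordf R c).
Proof. exact: (@proj_continuous coord (fun=> R) c). Qed.

Lemma open_upd Omega p c : open Omega -> Omega p ->
  \forall s \near p c, Omega (upd p c s).
Proof.
move=> oO Op; apply: upd_continuous; rewrite upd_id.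
exact: open_nbhs_nbhs.
Qed.

Lemma partial_is_derive c f p v :
  is_derive (p c) (1 : R) (along c f p) v -> partial c f p = v.
Proof. by rewrite /partial derive1E => ?; rewrite derive_val. Qed.

Lemma is_derive_partial c f p : derivable (along c f p) (p c) 1 ->
  is_derive (p c) (1 : R) (along c f p) (partial c f p).
Proof. by rewrite /partial derive1E => /derivableP. Qed.

Lemma along_near_eq Omega f g p c : open Omega -> Omega p ->
    (forall q, Omega q -> f q = g q) ->
  \forall s \near p c, along c f p s = along c g p s.
Proof.
by move=> oO Op fg; apply: filterS (open_upd c oO Op) => s /fg.
Qed.

Lemma eq_partial Omega f g c : open Omega ->
    (forall q, Omega q -> f q = g q) ->
  forall p, Omega p -> partial c f p = partial c g p.
Proof.
move=> oO fg p Op; rewrite /partial !derive1E.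
exact/near_eq_derive/(along_near_eq c oO Op fg).
Qed.

(** * Dependence on finitely many coordinates *)

Definition depends_on A Omega f := forall p q, Omega p -> Omega q ->
  {in A, forall c, p c = q c} -> f p = f q.

Lemma depends_onW A B Omega f : {subset A <= B} ->
  depends_on A Omega f -> depends_on B Omega f.
Proof. by move=> AB fA p q Op Oq pq; apply: fA => // c /AB; exact: pq. Qed.

(** Moving the coordinate [c] keeps the point in the open set [Omega] only for values near [p c], so
    [f] is known to be constant along [c] only locally; this suffices for the derivative. *)
Lemma partial_notin A Omega f c p : open Omega -> depends_on A Omega f ->
  c \notin A -> Omega p -> partial c f p = 0.
Proof.
move=> oO fA cA Op; apply: partial_is_derive.
apply: (@near_eq_is_derive _ _ _ (cst (f p))).
apply: filterS (open_upd c oO Op) => s Os; apply: fA => // d dA.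
by apply: esym; apply: upd_other; apply: contraNneq cA => <-.
Qed.

(** If [c] is in [A], then [p c = q c] and the slices of [f] through [p] and [q] agree near that
    common value, so they have the same derivative there. *)
Lemma depends_on_partial A Omega f c : open Omega ->
  depends_on A Omega f -> depends_on A Omega (partial c f).
Proof.
move=> oO fA p q Op Oq pq; have [cA|cA] := boolP (c \in A); last first.
  by rewrite !(partial_notin oO fA cA).
rewrite /partial !derive1E -(pq _ cA); apply: near_eq_derive.
have Oq' := open_upd c oO Oq; rewrite -(pq _ cA) in Oq'.
near=> s; apply: fA.
- by near: s; exact: open_upd.
- by near: s.
- by move=> d dA; case: eqP => // _; exact: pq.
Unshelve. all: by end_near. Qed.

Lemma depends_on_eq A Omega f g : (forall q, Omega q -> f q = g q) ->
  depends_on A Omega f -> depends_on A Omega g.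
Proof. by move=> fg fA p q Op Oq pq; rewrite -!fg//; exact: fA. Qed.

Lemma depends_on_op2 (op : R -> R -> R) A B Omega f g :
    depends_on A Omega f -> depends_on B Omega g ->
  depends_on (A ++ B) Omega (fun p => op (f p) (g p)).
Proof.
move=> fA gB p q Op Oq pq; congr op.
- by apply: fA => // c cA; apply: pq; rewrite mem_cat cA.
- by apply: gB => // c cB; apply: pq; rewrite mem_cat cB orbT.
Qed.

(** * Differentiability of finite order *)

Definition C1 Omega f := forall p, Omega p ->
  {for p, continuous f} /\ forall c, derivable (along c f p) (p c) 1.

(** A recursive form of [smooth] that peels off the derivative taken first. In [foldr partial f s]
    that derivative is the last entry of [s], out of reach of an induction from the left; here the
    sum and product rules iterate by induction on [n] with [f] general. *)
Fixpoint Ck n Omega f : Prop :=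
  C1 Omega f /\ if n is n'.+1 then forall c, Ck n' Omega (partial c f) else True.

Lemma smoothP Omega f :
  smooth Omega f <-> finite_order Omega f /\ forall n, Ck n Omega f.
Proof.
split=> -[fA fs]; split=> //.
  move=> n; elim: n f fs {fA} => [|n IH] f fs /=.
    by split=> // p Op; exact: (fs [::] p Op).
  split; first by move=> p Op; exact: (fs [::] p Op).
  move=> c; apply: IH => s p Op.
  by have := fs (rcons s c) p Op; rewrite foldr_rcons.
move=> s; elim/last_ind: s f fs {fA} => [|s c IH] f fs p Op.
  by have [+ _] := fs 0%N; apply.
by rewrite foldr_rcons; apply: IH => // n; have [_] := fs n.+1; exact.
Qed.

Lemma C1_eq Omega f g : open Omega -> (forall q, Omega q -> f q = g q) ->
  C1 Omega f -> C1 Omega g.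
Proof.
move=> oO fg fC p Op; have [fc fd] := fC p Op; split.
  have nO : nbhs p Omega by exact: open_nbhs_nbhs.
  have fgp : {near p, f =1 g} by apply: filterS nO => q /fg.
  rewrite /prop_for /continuous_at -(fg _ Op).
  exact: cvg_trans (near_eq_cvg fgp) fc.
by move=> c; exact: near_eq_derivable (along_near_eq c oO Op fg) (fd c).
Qed.

Lemma Ck_eq n Omega f g : open Omega -> (forall q, Omega q -> f q = g q) ->
  Ck n Omega f -> Ck n Omega g.
Proof.
move=> oO; elim: n f g => [|n IH] f g fg /= [fC].
  by split; [exact: C1_eq fC|].
move=> fn; split; first exact: C1_eq fC.
by move=> c; apply: IH (fn c) => q; exact: eq_partial.
Qed.

Lemma CkW n Omega f : Ck n.+1 Omega f -> Ck n Omega f.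
Proof.
by elim: n f => [|n IH] f /= [fC fn]; split=> // c; apply: IH; exact: fn.
Qed.

Lemma smooth_eq Omega f g : open Omega -> (forall q, Omega q -> f q = g q) ->
  smooth Omega f -> smooth Omega g.
Proof.
move=> oO fg /smoothP[[A fA] fn]; apply/smoothP; split.
  by exists A; exact: depends_on_eq fA.
by move=> n; exact: Ck_eq (fn n).
Qed.

Lemma smooth_derivable Omega f p c : smooth Omega f -> Omega p ->
  is_derive (p c) (1 : R) (along c f p) (partial c f p).
Proof.
by move=> [_ fs] Op; apply: is_derive_partial; have [_] := fs [::] p Op; exact.
Qed.

Lemma smooth_continuous Omega f p : smooth Omega f -> Omega p ->
  {for p, continuous f}.
Proof. by move=> [_ fs] Op; have [] := fs [::] p Op. Qed.

Lemma smooth_partial Omega f c : open Omega ->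
  smooth Omega f -> smooth Omega (partial c f).
Proof.
move=> oO /smoothP[[A fA] fn]; apply/smoothP; split.
  by exists A; exact: depends_on_partial.
by move=> n; have [_] := fn n.+1; exact.
Qed.

Lemma C1_is_derive Omega f p c : C1 Omega f -> Omega p ->
  is_derive (p c) (1 : R) (along c f p) (partial c f p).
Proof. by move=> fC Op; apply: is_derive_partial; have [_] := fC p Op; exact. Qed.

Lemma C1_partialD Omega f g : C1 Omega f -> C1 Omega g ->
  forall p c, Omega p ->
  partial c (fun q => f q + g q) p = partial c f p + partial c g p.
Proof.
move=> fC gC p c Op; apply: partial_is_derive.
exact: is_deriveD (C1_is_derive c fC Op) (C1_is_derive c gC Op).
Qed.

Lemma C1_partialM Omega f g : C1 Omega f -> C1 Omega g ->
  forall p c, Omega p ->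
  partial c (fun q => f q * g q) p = partial c f p * g p + f p * partial c g p.
Proof.
move=> fC gC p c Op; apply: partial_is_derive.
apply: is_derive_eq; first
  exact: is_deriveM (C1_is_derive c fC Op) (C1_is_derive c gC Op).
rewrite !alongE upd_id addrC. by congr (_ + _); rewrite mulrC.
Qed.

Lemma C1D Omega f g : C1 Omega f -> C1 Omega g -> C1 Omega (fun q => f q + g q).
Proof.
move=> fC gC p Op; have [fc fd] := fC p Op; have [gc gd] := gC p Op.
by split; [exact: cvgD fc gc|move=> c; exact: derivableD (fd c) (gd c)].
Qed.

Lemma C1M Omega f g : C1 Omega f -> C1 Omega g -> C1 Omega (fun q => f q * g q).
Proof.
move=> fC gC p Op; have [fc fd] := fC p Op; have [gc gd] := gC p Op.
by split; [exact: cvgM fc gc|move=> c; exact: derivableM (fd c) (gd c)].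
Qed.

Lemma CkD n Omega f g : open Omega ->
  Ck n Omega f -> Ck n Omega g -> Ck n Omega (fun q => f q + g q).
Proof.
move=> oO; elim: n f g => [|n IH] f g [fC fn] [gC gn];
  (split; first exact: C1D fC gC); first exact: I.
move=> c; apply: (Ck_eq oO) (IH _ _ (fn c) (gn c)) => q Oq.
by rewrite (C1_partialD fC gC).
Qed.

Lemma CkM n Omega f g : open Omega ->
  Ck n Omega f -> Ck n Omega g -> Ck n Omega (fun q => f q * g q).
Proof.
move=> oO; elim: n f g => [|n IH] f g fS gS;
  have [fC fn] := fS; have [gC gn] := gS;
  (split; first exact: C1M fC gC); first exact: I.
(* The Leibniz rule pairs a derivative, of order n, with an undifferentiated factor of order n+1,
   which [CkW] lowers to n. *)
move=> c; have := CkD oO (IH _ _ (fn c) (CkW gS)) (IH _ _ (CkW fS) (gn c)).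
by apply: (Ck_eq oO) => q Oq; rewrite (C1_partialM fC gC).
Qed.

Lemma smoothD Omega f g : open Omega ->
  smooth Omega f -> smooth Omega g -> smooth Omega (fun q => f q + g q).
Proof.
move=> oO /smoothP[[A fA] fn] /smoothP[[B gB] gn]; apply/smoothP; split.
  by exists (A ++ B); exact: depends_on_op2.
by move=> n; exact: CkD.
Qed.

Lemma smoothM Omega f g : open Omega ->
  smooth Omega f -> smooth Omega g -> smooth Omega (fun q => f q * g q).
Proof.
move=> oO /smoothP[[A fA] fn] /smoothP[[B gB] gn]; apply/smoothP; split.
  by exists (A ++ B); exact: depends_on_op2.
by move=> n; exact: CkM.
Qed.

(** * Functions of a single coordinate *)

Lemma is_derive_along_coord (phi : R -> R) c d p v :
  is_derive (p c) (1 : R) phi v ->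
  is_derive (p d) (1 : R) (along d (fun q => phi (q c)) p)
    (if c == d then v else 0).
Proof.
move=> dphi; rewrite alongE /upd; case: eqVneq => [<-//|_].
exact: is_derive_cst.
Qed.

Lemma C1_coord_comp Omega c (phi psi : R -> R) :
    (forall p, Omega p -> is_derive (p c) (1 : R) phi (psi (p c))) ->
  C1 Omega (fun p => phi (p c)).
Proof.
move=> dphi p Op; have dp := dphi p Op; split.
  apply: (@continuous_comp _ _ _ (@coordf R c) phi).
    exact: coordf_continuous.
  exact/differentiable_continuous/derivable1_diffP.
by move=> d; have [] := is_derive_along_coord d dp.
Qed.

Lemma CkS_coord_comp n Omega c (phi psi : R -> R) : open Omega ->
    (forall p, Omega p -> is_derive (p c) (1 : R) phi (psi (p c))) ->
    Ck n Omega (fun p => psi (p c)) -> Ck n Omega (fun=> 0) ->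
  Ck n.+1 Omega (fun p => phi (p c)).
Proof.
move=> oO dphi psin zeron; split; first exact: C1_coord_comp dphi.
move=> d; have [cd|cd] := eqVneq c d.
  apply: Ck_eq psin => // q Oq; apply/esym/partial_is_derive.
  by have := is_derive_along_coord d (dphi _ Oq); rewrite cd eqxx.
apply: Ck_eq zeron => // q Oq; apply/esym/partial_is_derive.
by have := is_derive_along_coord d (dphi _ Oq); rewrite (negPf cd).
Qed.

(** A family of one-variable functions closed under differentiation on [D] consists of smooth
    functions of [c]. The zero function must belong to it, being the derivative in every other
    coordinate. *)
Lemma smooth_coord_family (K : (R -> R) -> Prop) (D : set R) Omega c phi :
    open Omega -> (forall p, Omega p -> D (p c)) ->
    (forall phi, K phi -> exists2 psi, K psi &
      forall a, D a -> is_derive a (1 : R) phi (psi a)) ->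
  K phi -> K (cst 0) -> smooth Omega (fun p => phi (p c)).
Proof.
move=> oO OD Kd Kphi K0; apply/smoothP; split.
  by exists [:: c] => p q _ _ /(_ c); rewrite inE eqxx => ->.
move=> n; elim: n phi Kphi => [|n IH] phi Kphi;
  have [psi Kpsi dphi] := Kd _ Kphi;
  have {}dphi p (Op : Omega p) := dphi _ (OD _ Op).
  by split=> //; exact: C1_coord_comp dphi.
exact: CkS_coord_comp oO dphi (IH _ Kpsi) (IH _ K0).
Qed.

Lemma smooth_coordf Omega c : open Omega -> smooth Omega (@coordf R c).
Proof.
move=> oO.
apply: (@smooth_coord_family
  (fun phi => phi = id \/ exists k, phi = cst k) setT _ c id) => //; last 2 first.
- by left.
- by right; exists 0.
move=> phi [->|[k ->]].
  by exists (cst 1); [right; exists 1|move=> a _; exact: is_derive_id].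
by exists (cst 0); [right; exists 0|move=> a _; exact: is_derive_cst].
Qed.

Lemma smooth_cst Omega (k : R) : open Omega -> smooth Omega (fun=> k).
Proof.
move=> oO; apply: (@smooth_coord_family
  (fun phi => exists k, phi = cst k) setT _ (base dx) (cst k)) => //.
- move=> phi [k' ->].
  by exists (cst 0); [exists 0|move=> a _; exact: is_derive_cst].
- by exists k.
- by exists 0.
Qed.

(** Serves the logarithm, which is reached from its derivative, an inverse already known to be
    smooth. *)
Lemma smooth_antiderivative Omega c (phi psi : R -> R) : open Omega ->
    (forall p, Omega p -> is_derive (p c) (1 : R) phi (psi (p c))) ->
    smooth Omega (fun p => psi (p c)) ->
  smooth Omega (fun p => phi (p c)).
Proof.
move=> oO dphi /smoothP[_ psin]; apply/smoothP; split.
  by exists [:: c] => p q _ _ /(_ c); rewrite inE eqxx => ->.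
have /smoothP[_ zeron] := smooth_cst 0 oO.
move=> [|n]; last exact: CkS_coord_comp oO dphi (psin n) (zeron n).
by split=> //; exact: C1_coord_comp dphi.
Qed.

Lemma smooth_sum Omega (I : Type) (r : seq I) (F : I -> jetpt R -> R) :
  open Omega -> (forall i, smooth Omega (F i)) ->
  smooth Omega (fun p => \sum_(i <- r) F i p).
Proof.
move=> oO Fs; elim: r => [|i r IH].
  apply: (@smooth_eq _ (fun=> 0)) oO _ (smooth_cst 0 oO) => q _.
  by rewrite big_nil.
apply: (@smooth_eq _ (fun q => F i q + \sum_(j <- r) F j q)) oO _
  (smoothD oO (Fs i) IH) => q _.
by rewrite big_cons.
Qed.

End SmoothFunctions.

(** * Symmetry of second partial derivatives *)

Section Schwarz.
Context {R : realType}.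
Implicit Types (f : jetpt R -> R) (p q : jetpt R) (Omega W : set (jetpt R)).
Implicit Types (c d : coord).

Lemma is_derive_upd Omega f q c s : smooth Omega f -> Omega (upd q c s) ->
  is_derive s (1 : R) (fun r => f (upd q c r)) (partial c f (upd q c s)).
Proof.
by move=> fs Os; have := smooth_derivable c fs Os; rewrite upd_same along_upd.
Qed.

Lemma MVT_cc (phi dphi : R -> R) (a b : R) : a < b ->
    (forall s, a <= s <= b -> is_derive s (1 : R) phi (dphi s)) ->
  exists2 s, a <= s <= b & phi b - phi a = dphi s * (b - a).
Proof.
move=> ab dphiP; have [||s] := @MVT R phi dphi a b ab.
- by move=> s; rewrite in_itv/= => /andP[/ltW as_ /ltW sb]; apply: dphiP; rewrite as_.
- apply: derivable_within_continuous => s; rewrite in_itv/= => sab.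
  by have [] := dphiP s sab.
by rewrite in_itv/= => /andP[/ltW as_ /ltW sb] phiE; exists s; rewrite ?as_.
Qed.

(** The mean value theorem is used twice: along [c] for the increment of [f] in direction [d], then
    along [d] for [partial c f]. The set [W] records that the intermediate point stays in the
    square. *)
Lemma second_difference Omega W f p c d (a b h : R) : open Omega ->
    smooth Omega f -> W `<=` Omega -> 0 < h -> d != c ->
    (forall s t, a <= s <= a + h -> b <= t <= b + h ->
      W (upd (upd p d t) c s)) ->
  exists2 q, W q &
    f (upd (upd p d (b + h)) c (a + h)) - f (upd (upd p d b) c (a + h))
    - (f (upd (upd p d (b + h)) c a) - f (upd (upd p d b) c a))
    = partial d (partial c f) q * h * h.
Proof.
move=> oO fs WO h0 dc Wst.
have hb : b <= b + h <= b + h by rewrite lexx lerDl ltW.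
have lb : b <= b <= b + h by rewrite lexx lerDl ltW.
have iphi s : a <= s <= a + h -> is_derive s (1 : R)
    (fun r => f (upd (upd p d (b + h)) c r) - f (upd (upd p d b) c r))
    (partial c f (upd (upd p d (b + h)) c s) - partial c f (upd (upd p d b) c s)).
  by move=> sa; apply: is_deriveB; apply: is_derive_upd fs _; apply/WO/Wst.
have [s sah ->] := MVT_cc (ltr_pwDr h0 (lexx a)) iphi.
have ipsi t : b <= t <= b + h -> is_derive t (1 : R)
    (fun r => partial c f (upd (upd p c s) d r))
    (partial d (partial c f) (upd (upd p c s) d t)).
  move=> tb; apply: is_derive_upd (smooth_partial c oO fs) _.
  by rewrite -updC//; apply/WO/Wst.
have [t tbh] := MVT_cc (ltr_pwDr h0 (lexx b)) ipsi.
rewrite -!(updC p _ _ dc) => ->; rewrite ![_ + h - _]addrAC !subrr !add0r.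
by exists (upd (upd p d t) c s) => //; exact: Wst.
Qed.

(** The second difference over a square is symmetric in the two directions, so each mixed partial
    takes, somewhere in any neighbourhood of [p], a value that the other one takes there too.
    Continuity at [p] then forces equality. *)
Lemma partialC Omega f p c d : open Omega -> smooth Omega f -> Omega p ->
  partial c (partial d f) p = partial d (partial c f) p.
Proof.
move=> oO fs Op; have [->//|cd] := eqVneq c d.
have near_mixed (W : set (jetpt R)) : nbhs p W -> exists q q', [/\ W q, W q' &
    partial d (partial c f) q = partial c (partial d f) q'].
  move=> Wp; have WO : nbhs p (W `&` Omega).
    by apply: filterI => //; exact: open_nbhs_nbhs.
  have : nbhs (p c, p d) [set st : R * R | (W `&` Omega) (upd (upd p c st.1) d st.2)].
    by apply: upd2_continuous; rewrite !upd_id.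
  move=> [[A B] /= [/nbhs_ballP[e1 /= e10 Ae] /nbhs_ballP[e2 /= e20 Be]] AB].
  (* Half the smaller radius, so that the closed square of side [h] fits inside the product of the
     open balls. *)
  pose h := Num.min e1 e2 / 2.
  have m0 : 0 < Num.min e1 e2 by rewrite lt_min e10.
  have h0 : 0 < h by rewrite divr_gt0.
  have hm : h < Num.min e1 e2 by rewrite /h; lra.
  have rect s t : p c <= s <= p c + h -> p d <= t <= p d + h ->
      (W `&` Omega) (upd (upd p c s) d t).
    move: hm; rewrite lt_min => /andP[h1 h2] /andP[s1 s2] /andP[t1 t2].
    apply: (AB (s, t)); split; [apply: Ae|apply: Be]; rewrite /ball/= ltr_norml; lra.
  have dc : d != c by rewrite eq_sym.
  have [|q Wq Eq] := @second_difference Omega (W `&` Omega) f p c d (p c) (p d) h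
    oO fs (@subIsetr _ _ _) h0 dc.
    by move=> s t ? ?; rewrite (updC p _ _ dc); exact: rect.
  have [|q' Wq' Eq'] := @second_difference Omega (W `&` Omega) f p d c (p d) (p c) h
    oO fs (@subIsetr _ _ _) h0 cd.
    by move=> s t ? ?; exact: rect.
  exists q, q'; split; [by case: Wq|by case: Wq'|].
  apply: (mulIf (lt0r_neq0 h0)); apply: (mulIf (lt0r_neq0 h0)).
  apply: etrans (esym Eq) (etrans _ Eq').
  have E s t := updC p s t dc.
  rewrite (E (p d + h) (p c + h)) (E (p d + h) (p c)) (E (p d) (p c + h)) (E (p d) (p c)).
  move: (f _) (f _) (f _) (f _) => x y z w.
  ring.
apply/eqP; rewrite -subr_eq0; apply/negPn/negP => ne0.
(* Half the supposed gap: each mixed partial stays within [e] of its value at [p], and the common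
   value at [q] and [q'] links the two estimates. *)
pose e := `|partial c (partial d f) p - partial d (partial c f) p| / 2.
have e0 : 0 < e by rewrite divr_gt0// normr_gt0.
have /cvgrPdist_lt/(_ _ e0) Ncd := smooth_continuous
  (smooth_partial c oO (smooth_partial d oO fs)) Op.
have /cvgrPdist_lt/(_ _ e0) Ndc := smooth_continuous
  (smooth_partial d oO (smooth_partial c oO fs)) Op.
have [q [q' [[_ Wq] [Wq' _] E]]] := near_mixed _ (filterI Ncd Ndc).
have : `|partial c (partial d f) p - partial d (partial c f) p| < e + e.
  rewrite -[X in `|X|](subrKA (partial c (partial d f) q')) -{2}E.
  apply: (le_lt_trans (ler_normD _ _)); apply: ltrD; first exact: Wq'.
  by rewrite distrC; exact: Wq.
by rewrite /e -splitr ltxx.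
Qed.

End Schwarz.

(** * Vector fields *)

Section VectorFields.
Context {R : realType}.
Implicit Types (f g : jetpt R -> R) (p q : jetpt R) (Omega : set (jetpt R)).
Implicit Types (c d : coord) (A : seq coord) (X Y : @vfield R).

Lemma smooth_depends_on Omega f : smooth Omega f ->
  exists2 A, uniq A & depends_on A Omega f.
Proof.
move=> [[A fA] _]; exists (undup A); first exact: undup_uniq.
by apply: depends_onW fA => c; rewrite mem_undup.
Qed.

Lemma smooth_depends_on2 Omega f g : smooth Omega f -> smooth Omega g ->
  exists A, [/\ uniq A, depends_on A Omega f & depends_on A Omega g].
Proof.
move=> [[A fA] _] [[B gB] _]; exists (undup (A ++ B)); split.
- exact: undup_uniq.
- by apply: depends_onW fA => c cA; rewrite mem_undup mem_cat cA.
- by apply: depends_onW gB => c cB; rewrite mem_undup mem_cat cB orbT.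
Qed.

(** Partials outside [A] vanish, so the formal sum is finite. Any list bounding the dependence of
    [f] will do, which lets several functions share one list. *)
Lemma actE A Omega X f p : open Omega -> uniq A -> depends_on A Omega f ->
  Omega p -> act X f p = \sum_(c <- A) X c p * partial c f p.
Proof.
move=> oO uA fA Op; rewrite /act -(fsbig_widen [set` A] setT)//; last first.
  move=> c [_ /= /negP cA]; apply/eqP.
  by rewrite (partial_notin oO fA cA Op) mulr0.
by rewrite [RHS]fsbig_seq.
Qed.

Lemma eq_act Omega X f g : open Omega -> (forall q, Omega q -> f q = g q) ->
  forall p, Omega p -> act X f p = act X g p.
Proof.
move=> oO fg p Op; apply: eq_fsbigr => c _.
by rewrite (eq_partial c oO fg Op).
Qed.

Lemma actD Omega X f g p : open Omega -> smooth Omega f -> smooth Omega g ->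
  Omega p -> act X (fun q => f q + g q) p = act X f p + act X g p.
Proof.
move=> oO fs gs Op; have [A [uA fA gA]] := smooth_depends_on2 fs gs.
have fgA : depends_on A Omega (fun q => f q + g q).
  by move=> r s Or Os rs; rewrite (fA _ _ Or Os rs) (gA _ _ Or Os rs).
rewrite (actE X oO uA fA Op) (actE X oO uA gA Op) (actE X oO uA fgA Op).
rewrite -big_split/=; apply: eq_bigr => c _.
have /smoothP[_ /(_ 0%N)[fC _]] := fs; have /smoothP[_ /(_ 0%N)[gC _]] := gs.
by rewrite (C1_partialD fC gC)// mulrDr.
Qed.

Lemma actM Omega X f g p : open Omega -> smooth Omega f -> smooth Omega g ->
  Omega p -> act X (fun q => f q * g q) p = act X f p * g p + f p * act X g p.
Proof.
move=> oO fs gs Op; have [A [uA fA gA]] := smooth_depends_on2 fs gs.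
have fgA : depends_on A Omega (fun q => f q * g q).
  by move=> r s Or Os rs; rewrite (fA _ _ Or Os rs) (gA _ _ Or Os rs).
rewrite (actE X oO uA fA Op) (actE X oO uA gA Op) (actE X oO uA fgA Op).
rewrite mulr_suml mulr_sumr -big_split/=; apply: eq_bigr => c _.
have /smoothP[_ /(_ 0%N)[fC _]] := fs; have /smoothP[_ /(_ 0%N)[gC _]] := gs.
by rewrite (C1_partialM fC gC)// mulrDr mulrA [f p * (_ * _)]mulrCA.
Qed.

Lemma act_coord_comp X (phi : R -> R) c p v :
  is_derive (p c) (1 : R) phi v -> act X (fun q => phi (q c)) p = X c p * v.
Proof.
move=> dphi; have dep : depends_on [:: c] setT (fun q : jetpt R => phi (q c)).
  by move=> r s _ _ /(_ c); rewrite inE eqxx => ->.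
rewrite (actE X openT _ dep)// big_seq1; congr (_ * _).
apply: partial_is_derive; have := is_derive_along_coord c dphi.
by rewrite eqxx.
Qed.

Lemma act_coordf X c p : act X (coordf c) p = X c p.
Proof. by rewrite (@act_coord_comp X id c p 1)// mulr1. Qed.

Lemma act_cst X (k : R) p : act X (fun=> k) p = 0.
Proof.
have dep : depends_on [::] setT (fun _ : jetpt R => k) by [].
by rewrite (actE X openT _ dep)// big_nil.
Qed.

Lemma actN Omega X f p : open Omega -> smooth Omega f -> Omega p ->
  act X (fun q => - f q) p = - act X f p.
Proof.
move=> oO fs Op.
have -> : act X (fun q => - f q) p = act X (fun q => -1 * f q) p.
  by apply: (@eq_act Omega X _ _ oO _ p Op) => q _; rewrite mulN1r.
rewrite (actM X oO (smooth_cst _ oO) fs Op).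
by rewrite act_cst mul0r add0r mulN1r.
Qed.

Lemma smoothN Omega f : open Omega -> smooth Omega f ->
  smooth Omega (fun q => - f q).
Proof.
move=> oO fs; apply: (smooth_eq oO) (smoothM oO (smooth_cst (-1) oO) fs).
by move=> q _; rewrite mulN1r.
Qed.

Lemma act_sum Omega X (I : Type) (r : seq I) (F : I -> jetpt R -> R) p :
    open Omega -> (forall i, smooth Omega (F i)) -> Omega p ->
  act X (fun q => \sum_(i <- r) F i q) p = \sum_(i <- r) act X (F i) p.
Proof.
move=> oO Fs Op; elim: r => [|i r IH].
  rewrite big_nil; apply: etrans _ (act_cst X 0 p).
  apply: (@eq_act Omega X _ (fun=> 0) oO _ p Op) => q _.
  by rewrite big_nil.
rewrite big_cons -IH -(actD X oO (Fs i) (smooth_sum r oO Fs) Op).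
apply: (@eq_act Omega X _ (fun q => F i q + \sum_(j <- r) F j q) oO _ p Op) => q _.
by rewrite big_cons.
Qed.

Lemma smooth_act Omega X f : open Omega -> (forall c, smooth Omega (X c)) ->
  smooth Omega f -> smooth Omega (act X f).
Proof.
move=> oO Xs fs; have [A uA fA] := smooth_depends_on fs.
pose G c q := X c q * partial c f q.
have Gs c : smooth Omega (G c) by apply: (smoothM oO (Xs c) (smooth_partial c oO fs)).
apply: (smooth_eq oO) (smooth_sum A oO Gs) => q Oq.
by rewrite (actE X oO uA fA Oq).
Qed.

(** Partials of [f] still depend only on [A], so both indices of the second-order part run over the
    same finite list and can later be exchanged. *)
Lemma act_act A Omega X Y f p : open Omega -> uniq A -> depends_on A Omega f ->
    smooth Omega f -> (forall c, smooth Omega (Y c)) -> Omega p ->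
  act X (act Y f) p = \sum_(c <- A) act X (Y c) p * partial c f p
    + \sum_(c <- A) \sum_(d <- A) Y c p * (X d p * partial d (partial c f) p).
Proof.
move=> oO uA fA fs Ys Op; pose G c q := Y c q * partial c f q.
have Gs c : smooth Omega (G c) by apply: (smoothM oO (Ys c) (smooth_partial c oO fs)).
have -> : act X (act Y f) p = act X (fun q => \sum_(c <- A) G c q) p.
  by apply: (@eq_act Omega X _ _ oO _ p Op) => q Oq; rewrite (actE Y oO uA fA Oq).
rewrite (act_sum X A oO Gs Op) -big_split/=; apply: eq_bigr => c _.
rewrite (actM X oO (Ys c) (smooth_partial c oO fs) Op); congr (_ + _).
by rewrite (actE X oO uA (depends_on_partial c oO fA) Op) mulr_sumr.
Qed.

(* The second order terms of the commutator cancel by symmetry of the second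
   partial derivatives. *)
Lemma act_commutator Omega X Y f p : open Omega ->
    (forall c, smooth Omega (X c)) -> (forall c, smooth Omega (Y c)) ->
    smooth Omega f -> Omega p -> (forall c, act X (Y c) p = act Y (X c) p) ->
  act X (act Y f) p = act Y (act X f) p.
Proof.
move=> oO Xs Ys fs Op XY; have [A uA fA] := smooth_depends_on fs.
rewrite (act_act X oO uA fA fs Ys Op) (act_act Y oO uA fA fs Xs Op).
congr (_ + _); first by apply: eq_bigr => c _; rewrite XY.
rewrite exchange_big; apply: eq_bigr => d _; apply: eq_bigr => c _.
by rewrite (partialC c d oO fs Op) mulrCA.
Qed.

End VectorFields.

(** * Towers *)

Section Towers.
Context {R : realType}.
Implicit Types (f g h F T S : jetpt R -> R) (p q : jetpt R) (Omega : set (jetpt R)).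
Implicit Types (c : coord) (i k : dir) (U V : nat -> jetpt R -> R).

Lemma smooth_extD Omega i U : open Omega -> (forall j, smooth Omega (U j)) ->
  forall c, smooth Omega (extD i U c).
Proof.
move=> oO Us [k|a b c|j].
- by case: i; case: k; exact: smooth_cst.
- exact: smooth_coordf.
- exact: Us.
Qed.

(** Only the fibre coordinates carry a condition: the coefficients on t, x, y are constants, and
    u_{Iik} = u_{Iki} holds by computation because a multi-index is stored as three counts. *)
Lemma act_extD_comm i k U V p :
    (forall j, act (extD i U) (V j) p = act (extD k V) (U j) p) ->
  forall c, act (extD i U) (extD k V c) p = act (extD k V) (extD i U c) p.
Proof.
move=> UV [l|a b c|j]; last exact: UV.
- transitivity (0 : R); first by case: k {UV}; case: l; exact: act_cst.
  by case: i {UV}; case: l; rewrite act_cst.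
- rewrite -[extD k V _]/(coordf (jet_succ k a b c)).
  rewrite -[extD i U _]/(coordf (jet_succ i a b c)) !act_coordf.
  by case: i {UV}; case: k.
Qed.

(** Functions pulled back from the jet space. On these D~_i and D_i agree, which connects the D~_x^n
    F produced by the tower with the D_I F that define [prolongation]. *)
Definition on_base h := forall p q, (forall k, p (base k) = q (base k)) ->
  (forall l m n, p (jet l m n) = q (jet l m n)) -> h p = h q.

Lemma on_base_partial_fibre h j p : on_base h -> partial (fibre j) h p = 0.
Proof.
move=> hb; rewrite /partial (_ : along _ _ _ = cst (h p)) ?derive1_cst//.
by apply/funext => s; apply: hb => *; apply: upd_other; apply/eqP.
Qed.

Lemma act_extD_on_base i U h : on_base h -> act (extD i U) h = act (totalD i) h.
Proof.
move=> hb; apply/funext => p; apply: eq_fsbigr => -[k|a b c|j] _ //.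
by rewrite (on_base_partial_fibre j p hb) !mulr0.
Qed.

Lemma on_base_act_totalD i h : on_base h -> on_base (act (totalD i) h).
Proof.
move=> hb p q pqb pqj; apply: eq_fsbigr => -[k|a b c|j] _.
- rewrite /partial (_ : along _ h p = along (base k) h q) ?pqb//.
  by apply/funext => s; apply: hb => *; rewrite ?pqb ?pqj.
- rewrite /partial (_ : along _ h p = along (jet a b c) h q) ?pqj//.
    by case: i => /=; rewrite pqj.
  by apply/funext => s; apply: hb => *; rewrite ?pqb ?pqj.
- by rewrite !(on_base_partial_fibre _ _ hb) !mulr0.
Qed.

Local Notation Dx := (act (extD dx shift_coef)).

Lemma iter_Dx_on_base F n : on_base F ->
  iter n Dx F = foldr (fun i => act (totalD i)) F (nseq n dx) /\
  on_base (iter n Dx F).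
Proof.
move=> Fb; elim: n => [//|n [IH nb]]; rewrite iterS act_extD_on_base//= -IH.
by split=> //; exact: on_base_act_totalD.
Qed.

Lemma smooth_shift Omega j : open Omega -> smooth Omega (@shift_coef R j).
Proof. exact: smooth_coordf. Qed.

Lemma smooth_iter_Dx Omega n f : open Omega -> smooth Omega f ->
  smooth Omega (iter n Dx f).
Proof.
move=> oO fs; elim: n => [|n IH]; first exact: fs.
exact: smooth_act oO (smooth_extD dx oO (fun j => smooth_shift j oO)) IH.
Qed.

Lemma eq_iter_Dx Omega n f g : open Omega -> (forall q, Omega q -> f q = g q) ->
  forall p, Omega p -> iter n Dx f p = iter n Dx g p.
Proof. by move=> oO fg; elim: n => [//|n IH] p Op /=; exact: (eq_act _ oO IH). Qed.

Lemma iter_DxD Omega n f g p : open Omega -> smooth Omega f -> smooth Omega g ->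
  Omega p -> iter n Dx (fun q => f q + g q) p = iter n Dx f p + iter n Dx g p.
Proof.
move=> oO fs gs; elim: n p => [//|n IH] p Op /=.
rewrite (eq_act _ oO IH Op).
exact: (actD _ oO (smooth_iter_Dx n oO fs) (smooth_iter_Dx n oO gs) Op).
Qed.

(** With [n] and [b] general, one Leibniz step gives two terms of the same shape with [m] lowered,
    so the induction needs no binomial formula. *)
Lemma iter_DxM_eq0 Omega F b m n p : open Omega -> smooth Omega F ->
    smooth Omega b -> Omega p -> (forall l, iter l Dx F p = 0) ->
  iter m Dx (fun q => b q * iter n Dx F q) p = 0.
Proof.
move=> oO Fs bs Op F0; elim: m n b bs => [|m IH] n b bs.
  by rewrite /= F0 mulr0.
have bDs : smooth Omega (Dx b) by exact: (smooth_iter_Dx 1 oO bs).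
have Fns l : smooth Omega (iter l Dx F) by exact: smooth_iter_Dx.
have Leibniz q : Omega q -> Dx (fun r => b r * iter n Dx F r) q =
    Dx b q * iter n Dx F q + b q * iter n.+1 Dx F q.
  by move=> Oq; rewrite (actM _ oO bs (Fns n) Oq).
rewrite iterSr (eq_iter_Dx m oO Leibniz Op).
rewrite (iter_DxD m oO (smoothM oO bDs (Fns n)) (smoothM oO bs (Fns n.+1)) Op).
by rewrite (IH n _ bDs) (IH n.+1 _ bs) addr0.
Qed.

Lemma smooth_tower Omega T S i j : open Omega -> smooth Omega T ->
  smooth Omega S -> smooth Omega (tower T S i j).
Proof.
move=> oO Ts Ss; case: i; [exact: smooth_iter_Dx|exact: smooth_shift|].
exact: smooth_iter_Dx.
Qed.

(** On v_j both orders give the (j+1)-st coefficient of the tower, which is by construction D~_x of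
    the j-th. *)
Lemma tower_act_Dx Omega T S i f p : open Omega -> smooth Omega T ->
    smooth Omega S -> smooth Omega f -> Omega p ->
  act (extD i (tower T S i)) (Dx f) p = Dx (act (extD i (tower T S i)) f) p.
Proof.
move=> oO Ts Ss fs Op.
have Xs := smooth_extD i oO (fun j => smooth_tower i j oO Ts Ss).
have Ys := smooth_extD dx oO (fun j => smooth_shift j oO).
apply: (act_commutator oO Xs Ys fs Op); apply: act_extD_comm => j.
rewrite /shift_coef act_coordf.
by case: i {Xs} => //=; rewrite act_coordf.
Qed.

Lemma tower_act_iter_Dx Omega T S i f n p : open Omega -> smooth Omega T ->
    smooth Omega S -> smooth Omega f -> Omega p ->
  act (extD i (tower T S i)) (iter n Dx f) p =
  iter n Dx (act (extD i (tower T S i)) f) p.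
Proof.
move=> oO Ts Ss fs; elim: n p => [//|n IH] p Op /=.
rewrite (tower_act_Dx i oO Ts Ss (smooth_iter_Dx n oO fs) Op).
exact: (eq_act _ oO IH Op).
Qed.

(** The hypothesis relating [T] and [S] is an identity on all of [Omega], with the multiple [b] of
    [F] explicit; it is differentiated first and restricted to the prolongation only at the end. *)
Lemma tower_is_covering Omega F b T S : open Omega -> smooth Omega F ->
    on_base F -> smooth Omega b -> smooth Omega T -> smooth Omega S ->
    (forall p, Omega p -> act (extD dt (tower T S dt)) S p =
       act (extD dy (tower T S dy)) T p + b p * F p) ->
  is_covering Omega (prolongation F) (tower T S).
Proof.
move=> oO Fs Fb bs Ts Ss TS.
have Xs i := smooth_extD i oO (fun j => smooth_tower i j oO Ts Ss).
split=> [//|i j|]; first exact: smooth_tower.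
have tx i f p : smooth Omega f -> Omega p ->
    act (extD i (tower T S i)) (act (extD dx (tower T S dx)) f) p =
    act (extD dx (tower T S dx)) (act (extD i (tower T S i)) f) p.
  exact: tower_act_Dx.
have ty f p : smooth Omega f -> Omega p -> prolongation F p ->
    act (extD dt (tower T S dt)) (act (extD dy (tower T S dy)) f) p =
    act (extD dy (tower T S dy)) (act (extD dt (tower T S dt)) f) p.
  move=> fs Op Ep; apply: (act_commutator oO (Xs dt) (Xs dy) fs Op).
  apply: act_extD_comm => j.
  rewrite [LHS](tower_act_iter_Dx dt j oO Ts Ss Ss Op).
  rewrite [RHS](tower_act_iter_Dx dy j oO Ts Ss Ts Op).
  rewrite (eq_iter_Dx j oO TS Op).
  rewrite (iter_DxD j oO (smooth_act oO (Xs dy) Ts) (smoothM oO bs Fs) Op).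
  rewrite (iter_DxM_eq0 j 0 oO Fs bs Op) ?addr0// => l.
  by rewrite (iter_Dx_on_base l Fb).1; exact: Ep.
by case=> [] [] f fs p Op Ep; rewrite ?(tx _ _ _ fs Op) ?(ty _ _ fs Op Ep).
Qed.

End Towers.

(** * Real powers and logarithms *)

Section RealPowers.
Context {R : realType}.
Implicit Types (a r : R) (z : int).

Lemma rpow_intr a z : rpow a z%:~R = a ^ z.
Proof. by rewrite /rpow intr_int intrKfloor. Qed.

Lemma rpow_powR a r : 0 < a -> rpow a r = a `^ r.
Proof.
move=> a0; rewrite /rpow; case: ifPn => // /floorK rE.
by rewrite -[in RHS]rE powR_intmul// ltW.
Qed.

Lemma rpow_domP r a :
  rpow_dom r a <-> 0 < a \/ exists2 z, r = z%:~R & a != 0 \/ 0 <= z.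
Proof.
split=> -[a0|[]]; try by left.
- by move=> /intrP[z rE] az; right; exists z; rewrite // -(ler0z R) -rE.
- by move=> z -> az; right; rewrite intr_int ler0z.
Qed.

(** A nonzero integer exponent z >= 0 has z - 1 >= 0, so 0 stays in the domain. For r = 0 it would
    be lost. *)
Lemma rpow_domB1 r a : r != 0 -> rpow_dom r a -> rpow_dom (r - 1) a.
Proof.
move=> r0 /rpow_domP[a0|[z rE az]]; apply/rpow_domP; first by left.
right; exists (z - 1); first by rewrite rE intrB.
case: az => [az|z0]; [by left|right].
by move: r0; rewrite rE intr_eq0; lia.
Qed.

Lemma is_derive_exprn n a :
  is_derive a (1 : R) (fun b => b ^+ n) (n%:R * a ^+ n.-1).
Proof.
apply: DeriveDef; first exact: exprn_derivable.
by rewrite -derive1E exp_derive1.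
Qed.

(* For [r = 0] the factor [r] cancels the junk value of [rpow 0 (- 1)]. *)
Lemma is_derive_rpow r a : rpow_dom r a ->
  is_derive a (1 : R) (fun b => rpow b r) (r * rpow a (r - 1)).
Proof.
move=> /rpow_domP[a0|[z -> az]].
  apply: (@near_eq_is_derive _ _ _ (fun b => b `^ r)).
    by near=> b; rewrite rpow_powR//; near: b; exact: lt_nbhsr.
  have aI : a \in `]0, +oo[ by rewrite in_itv/= andbT.
  by rewrite (rpow_powR _ a0) -(powR_derive1 _ aI) derive1E; apply/derivableP/derivable_powR.
have -> : (fun b => rpow b z%:~R) = (fun b => b ^ z) :> (R -> R).
  by apply/funext => b; rewrite rpow_intr.
have zB1 : z%:~R - 1 = (z - 1)%:~R :> R by rewrite intrB.
rewrite zB1 rpow_intr.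
case: z az {zB1} => [[|n]|n] az.
- by rewrite mul0r; exact: is_derive_cst.
- rewrite (_ : Posz n.+1 - 1 = n)//; last by lia.
  exact: is_derive_exprn.
have a0 : a != 0 by case: az => //; lia.
have an0 : a ^+ n.+1 != 0 by rewrite expf_neq0.
rewrite (_ : Negz n - 1 = Negz n.+1); last by lia.
apply: is_derive_eq.
  exact: (@is_deriveV _ (fun b => b ^+ n.+1) _ _ _ an0 (is_derive_exprn n.+1 a)).
rewrite /GRing.scale/= !NegzE mulrNz -!exprnN !exprS.
by rewrite -pmulrn; field; rewrite a0 expf_neq0.
Unshelve. all: by end_near.
Qed.

(** At r = 0 and a = 0 the two sides would be 0 and 1. *)
Lemma mulr_rpowB1 r a : r != 0 -> rpow_dom r a -> a * rpow a (r - 1) = rpow a r.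
Proof.
move=> r0 /rpow_domP[a0|[z rE az]].
  rewrite !rpow_powR// -[in X in X * _](powRr1 (ltW a0)).
  by rewrite -powRD ?(gt_eqF a0) ?implybT// addrC subrK.
have zB1 : z%:~R - 1 = (z - 1)%:~R :> R by rewrite intrB.
move: r0; rewrite rE intr_eq0 zB1 !rpow_intr => z0.
case: az => [a0|zge0].
  by rewrite -[in X in X * _](expr1z a) -expfzDr// addrC subrK.
case: z {rE zB1} z0 zge0 => [[|n]|n] // _ _.
by rewrite (_ : Posz n.+1 - 1 = n) ?exprSz//; lia.
Qed.

(** The domain matters: for a < 0 and a half-integer r, the left side is an algebraic power while
    [rpow a r] is a junk value. *)
Lemma rpow_sqr r a : rpow_dom r a -> rpow a (2 * r) = rpow a r ^+ 2.
Proof.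
move=> /rpow_domP[a0|[z -> _]].
  by rewrite !rpow_powR// mulrC powRrM powR_mulrn// powR_ge0.
by rewrite -[2]/(2%:~R) -intrM !rpow_intr mulrC -exprz_exp.
Qed.

Lemma open_rpow_dom r : open (@rpow_dom R r).
Proof.
have [rI|rI] := boolP (r \is a Num.int); last first.
  rewrite (_ : rpow_dom r = [set a | 0 < a]); first exact: open_gt.
  apply/seteqP; split=> a /=; rewrite /rpow_dom/= (negPf rI); last by left.
  by case=> // -[].
have [r0|r0] := leP 0 r.
  rewrite (_ : rpow_dom r = setT); first exact: openT.
  by apply/seteqP; split=> a //= _; right; split=> //; right.
rewrite (_ : rpow_dom r = [set a | a != 0]); first exact: open_neq.
apply/seteqP; split=> a /=; rewrite /rpow_dom/= (lt_geF r0) rI.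
  by case=> [/lt0r_neq0//|[_ []]].
by right; split=> //; left.
Qed.

Lemma smooth_rpow (Omega : set (jetpt R)) c r : open Omega ->
  (forall p, Omega p -> rpow_dom r (p c)) ->
  smooth Omega (fun p => rpow (p c) r).
Proof.
(* The family of multiples k a^s. For a nonnegative integer r, repeated differentiation reaches
   exponent 0 and then a negative one, undefined at 0, but by then the factor k is 0; the
   disjunction in [K] records this. *)
move=> oO Or; pose K (phi : R -> R) := exists k s, phi = (fun a => k * rpow a s) /\
  (k = 0 \/ rpow_dom r `<=` rpow_dom s).
have Kr : K (fun a => rpow a r).
  by exists 1, r; split; [apply/funext => a; rewrite mul1r|right].
have K0 : K (cst 0).
  by exists 0, r; split; [apply/funext => a; rewrite mul0r|left].
apply: (smooth_coord_family oO Or _ Kr K0).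
move=> _ [k [s [-> ks]]].
have [k0|k0] := eqVneq k 0.
  exists (cst 0) => [|a _]; first exact: K0.
  rewrite (_ : (fun=> _) = cst 0); first exact: is_derive_cst.
  by apply/funext => b; rewrite k0 mul0r.
have {ks} rs : rpow_dom r `<=` rpow_dom s by case: ks => // /eqP; rewrite (negPf k0).
exists (fun a => (k * s) * rpow a (s - 1)).
  exists (k * s), (s - 1); split=> //; have [->|s0] := eqVneq s 0.
    by left; rewrite mulr0.
  by right => a /rs; exact: rpow_domB1.
by move=> a /rs/is_derive_rpow da; rewrite -mulrA; exact: is_deriveZ.
Qed.

Lemma is_derive_ln_norm a : a != 0 ->
  is_derive a (1 : R) (fun b => ln `|b|) a^-1.
Proof.
move=> a0; have [aneg|apos|aE] := ltrgtP a 0; last by rewrite aE eqxx in a0.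
  apply: (@near_eq_is_derive _ _ _ (@ln R \o -%R)).
    near=> b; rewrite /= ltr0_norm//; near: b; exact: lt_nbhsl.
  have na : 0 < - a by rewrite oppr_gt0.
  apply: is_derive_eq; first
    exact: (is_derive1_comp (is_derive1_ln na) (is_deriveNid a 1)).
  by rewrite invrN mulrN1 opprK.
apply: (@near_eq_is_derive _ _ _ (@ln R)); last exact: is_derive1_ln.
near=> b; rewrite /= gtr0_norm//; near: b; exact: lt_nbhsr.
Unshelve. all: by end_near.
Qed.

End RealPowers.

(** * The six coverings *)

Section HasAct.
Context {R : realType}.
Implicit Types (f g T S : jetpt R -> R) (p q : jetpt R) (Omega : set (jetpt R)).

(** One derivation of this predicate yields smoothness together with a formula valid for every field
    [X]; for [T] the formula is used with both D~_x and D~_y, for [S] with both D~_x and D~_t. *)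
Definition has_act Omega f (D : @vfield R -> jetpt R -> R) :=
  smooth Omega f /\ forall X p, Omega p -> act X f p = D X p.

Lemma has_act_smooth Omega f D : has_act Omega f D -> smooth Omega f.
Proof. by case. Qed.

Section Calculus.
Variables (Omega : set (jetpt R)) (oO : open Omega).

Lemma has_act_cst (k : R) : has_act Omega (fun=> k) (fun _ _ => 0).
Proof. by split=> [|X p _]; [exact: smooth_cst|exact: act_cst]. Qed.

Lemma has_act_coordf c : has_act Omega (@coordf R c) (fun X p => X c p).
Proof. by split=> [|X p _]; [exact: smooth_coordf|exact: act_coordf]. Qed.

Lemma has_actD f g D E : has_act Omega f D -> has_act Omega g E ->
  has_act Omega (fun p => f p + g p) (fun X p => D X p + E X p).
Proof.
move=> [fs fD] [gs gE]; split=> [|X p Op]; first exact: smoothD.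
by rewrite (actD X oO fs gs Op) fD// gE.
Qed.

Lemma has_actN f D : has_act Omega f D ->
  has_act Omega (fun p => - f p) (fun X p => - D X p).
Proof.
move=> [fs fD]; split=> [|X p Op]; first exact: smoothN.
by rewrite (actN X oO fs Op) fD.
Qed.

Lemma has_actM f g D E : has_act Omega f D -> has_act Omega g E ->
  has_act Omega (fun p => f p * g p) (fun X p => D X p * g p + f p * E X p).
Proof.
move=> [fs fD] [gs gE]; split=> [|X p Op]; first exact: smoothM.
by rewrite (actM X oO fs gs Op) fD// gE.
Qed.

Lemma has_act_rpow c r : (forall p, Omega p -> rpow_dom r (p c)) ->
  has_act Omega (fun p => rpow (coordf c p) r)
    (fun X p => X c p * (r * rpow (coordf c p) (r - 1))).
Proof.
move=> Or; split=> [|X p Op]; first exact: smooth_rpow.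
exact/(@act_coord_comp _ X (fun a => rpow a r))/is_derive_rpow/Or.
Qed.

Lemma smooth_inv c : (forall p, Omega p -> p c != 0) ->
  smooth Omega (fun p => (coordf c p)^-1).
Proof.
move=> O0; have Odom p : Omega p -> rpow_dom (-1) (p c).
  by move=> /O0 p0; right; rewrite rpredN int_num1; split=> //; left.
apply: (smooth_eq oO) (smooth_rpow oO Odom) => q Oq.
by rewrite -[-1]/((- 1)%:~R) rpow_intr exprN1.
Qed.

Lemma has_act_inv c : (forall p, Omega p -> p c != 0) ->
  has_act Omega (fun p => (coordf c p)^-1)
    (fun X p => X c p * - coordf c p ^- 2).
Proof.
move=> O0; split=> [|X p Op]; first exact: smooth_inv.
apply: (@act_coord_comp _ X (fun a => a^-1)).
apply: is_derive_eq; first exact: (@is_deriveV _ id _ _ _ (O0 p Op) (is_derive_id _ _)).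
exact: mulr1.
Qed.

Lemma has_act_sqrt_norm c : (forall p, Omega p -> 0 < p c) ->
  has_act Omega (fun p => Num.sqrt `|coordf c p|)
    (fun X p => X c p / (2 * Num.sqrt `|coordf c p|)).
Proof.
move=> O0; split=> [|X p Op].
  have Odom p : Omega p -> rpow_dom 2^-1 (p c) by left; exact: O0.
  apply: (smooth_eq oO) (smooth_rpow oO Odom) => q Oq.
  by rewrite rpow_powR ?O0// powR12_sqrt ?ltW ?O0// /coordf gtr0_norm ?O0.
have -> : act X (fun q => Num.sqrt `|coordf c q|) p = act X (fun q => Num.sqrt (q c)) p.
  by apply: (@eq_act _ Omega X _ _ oO _ p Op) => q /O0 q0; rewrite /coordf gtr0_norm.
rewrite /coordf gtr0_norm ?O0//.
exact/act_coord_comp/is_derive1_sqrt/O0.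
Qed.

Lemma has_act_ln_norm c : (forall p, Omega p -> p c != 0) ->
  has_act Omega (fun p => ln `|coordf c p|) (fun X p => X c p / coordf c p).
Proof.
move=> O0; have dln p (Op : Omega p) := is_derive_ln_norm (O0 p Op).
split=> [|X p Op]; last exact: (@act_coord_comp _ X (fun a => ln `|a|) c p _ (dln p Op)).
exact: smooth_antiderivative oO dln (smooth_inv O0).
Qed.

End Calculus.

Lemma on_base_equation (kappa : R) : on_base (equation kappa).
Proof.
move=> p q _ pq.
by rewrite /equation /u_yy /u_tx /u_x /u_y /u_xx /u_xy /coordf !pq.
Qed.

End HasAct.

(** Squares are handled as products by conversion. Powers, inverses, roots and logarithms are left
    as goals, since they need conditions on the domain. *)
Ltac prove_has_act oO :=
  repeat lazymatch goal with
  | |- has_act _ (fun p => @?f p + @?g p) _ => apply: (has_actD oO)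
  | |- has_act _ (fun p => - @?f p) _ => apply: (has_actN oO)
  | |- has_act _ (fun p => @?f p * @?g p) _ => apply: (has_actM oO)
  | |- has_act _ (fun p => @?f p ^+ 2) _ => apply: (has_actM oO)
  | |- _ => first [exact: (has_act_coordf oO) | exact: (has_act_cst oO)]
  end.

(** * The compatibility identity in each case *)

Section Cases.
Context {R : realType}.
Implicit Types (f g T S : jetpt R -> R) (p q : jetpt R) (Omega : set (jetpt R)).

Lemma smooth_equation Omega (kappa : R) : open Omega ->
  smooth Omega (equation kappa).
Proof.
by move=> oO; apply: has_act_smooth; rewrite /equation; prove_has_act oO.
Qed.

(** [U] and [V] stand for the fibre coefficients of D~_t and D~_y. Only their values on v_1, namely
    D~_x T and D~_x S, are supplied, because v_1 is the only fibre variable in [T] and [S]. *)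
Lemma equation_covering Omega (kappa : R) T S DT DS : open Omega ->
    has_act Omega T DT -> has_act Omega S DS ->
    (forall p (U V : nat -> jetpt R -> R), Omega p ->
      U 1 p = DT (extD dx shift_coef) p -> V 1 p = DS (extD dx shift_coef) p ->
      DS (extD dt U) p = DT (extD dy V) p + v_1 p * equation kappa p) ->
  is_covering Omega (prolongation (equation kappa)) (tower T S).
Proof.
move=> oO [Ts Ta] [Ss Sa] compat.
apply: (tower_is_covering oO (smooth_equation kappa oO)
  (@on_base_equation _ kappa) (smooth_coordf (fibre 1) oO) Ts Ss) => p Op.
by rewrite Sa// Ta//; apply: compat => //=; [exact: Ta|exact: Sa].
Qed.

Ltac jets := rewrite /= => -> ->; rewrite /shift_coef /equation /u_yy /u_tx /u_xy
  /u_xx /u_x /u_y /u /x_ /v_1 /coordf.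

Lemma linear_covering (kappa : R) :
   is_covering [set: jetpt R] (prolongation (equation kappa))
     (tower
        (fun p => (2^-1 * (kappa + 1) * u_x p ^+ 2 - u_y p) * v_1 p)
        (fun p => - (u_x p * v_1 p))).
Proof.
have oO : open [set: jetpt R] := openT.
apply: (equation_covering oO).
- by prove_has_act oO.
- by prove_has_act oO.
move=> p U V _; jets.
by field.
Qed.

Lemma power_covering (kappa : R) :
  kappa != -2 -> kappa != - (3 / 2) -> kappa != -1 ->
   is_covering
     [set p : jetpt R | rpow_dom (2 * kappa + 3) (v_1 p)
                        /\ rpow_dom (kappa + 2) (v_1 p)]
     (prolongation (equation kappa))
     (tower
        (fun p => (2 * kappa + 3)^-1 * rpow (v_1 p) (2 * kappa + 3)
                  - u_x p * rpow (v_1 p) (kappa + 2)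
                  + (2^-1 * (kappa + 1) * u_x p ^+ 2 - u_y p) * v_1 p)
        (fun p => (kappa + 2)^-1 * rpow (v_1 p) (kappa + 2)
                  - u_x p * v_1 p)).
Proof.
move=> k2 k32 _; set Omega := [set p : jetpt R | _].
have oO : open Omega.
  by apply: openI; apply: open_comp; [|exact: open_rpow_dom| |exact: open_rpow_dom];
    move=> p _; exact: coordf_continuous.
have Oa p : Omega p -> rpow_dom (2 * kappa + 3) (p (fibre 1)) by case.
have Ob p : Omega p -> rpow_dom (kappa + 2) (p (fibre 1)) by case.
have a0 : 2 * kappa + 3 != 0 by apply: contraNneq k32 => k0; apply/eqP; lra.
have b0 : kappa + 2 != 0 by apply: contraNneq k2 => k0; apply/eqP; lra.
apply: (equation_covering oO).
- by prove_has_act oO; exact: has_act_rpow.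
- by prove_has_act oO; exact: has_act_rpow.
move=> p U V Op; jets.
(* With w = v_1^(kappa+1), the power v_1^(kappa+2) becomes v_1 w and v_1^(2 kappa+2) becomes w^2,
   which leaves an identity for [field]. *)
rewrite -(mulr_rpowB1 b0 (Ob p Op)).
have -> : rpow (p (fibre 1)) (2 * kappa + 3 - 1) =
    rpow (p (fibre 1)) (kappa + 2 - 1) ^+ 2.
  rewrite -rpow_sqr; first by congr (rpow _ _); ring.
  exact: rpow_domB1 b0 (Ob p Op).
by field; rewrite ?a0 ?b0.
Qed.

(** The power formulas at kappa = -2, where v_1^(kappa+2)/(kappa+2) degenerates to a logarithm. *)
Lemma inverse_log_covering :
   is_covering [set p : jetpt R | v_1 p != 0] (prolongation (equation (-2)))
     (tower
        (fun p => - ((v_1 p)^-1 + u_x p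
                     + (2^-1 * u_x p ^+ 2 + u_y p) * v_1 p))
        (fun p => ln `|v_1 p| - u_x p * v_1 p)).
Proof.
set Omega := [set p : jetpt R | _].
have oO : open Omega.
  by apply: (@open_comp _ _ v_1 [set a | a != 0]);
    [move=> p _; exact: coordf_continuous|exact: open_neq].
have v0 p : Omega p -> p (fibre 1) != 0 by [].
apply: (equation_covering oO).
- by prove_has_act oO; exact: (has_act_inv oO v0).
- by prove_has_act oO; exact: (has_act_ln_norm oO v0).
move=> p U V p0; jets.
by field.
Qed.

(** The power formulas at kappa = -3/2, where kappa + 2 = 1/2 and v_1^(2 kappa+3)/(2 kappa+3)
    degenerates to a logarithm. *)
Lemma sqrt_log_covering :
   is_covering [set p : jetpt R | 0 < v_1 p] (prolongation (equation (- (3 / 2))))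
     (tower
        (fun p => - ((4^-1 * u_x p ^+ 2 + u_y p) * v_1 p
                     + u_x p * Num.sqrt `|v_1 p| - ln `|v_1 p|))
        (fun p => 2 * Num.sqrt `|v_1 p| - u_x p * v_1 p)).
Proof.
set Omega := [set p : jetpt R | _].
have oO : open Omega.
  by apply: (@open_comp _ _ v_1 [set a | 0 < a]);
    [move=> p _; exact: coordf_continuous|exact: open_gt].
have v_gt0 p : Omega p -> 0 < p (fibre 1) by [].
have v_neq0 p (Op : Omega p) : p (fibre 1) != 0 := lt0r_neq0 (v_gt0 p Op).
apply: (equation_covering oO).
- by prove_has_act oO;
    [exact: (has_act_sqrt_norm oO v_gt0)|exact: (has_act_ln_norm oO v_neq0)].
- by prove_has_act oO; exact: (has_act_sqrt_norm oO v_gt0).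
move=> p U V p0; jets.
have s0 : Num.sqrt `|p (fibre 1)| != 0.
  by rewrite gt_eqF// sqrtr_gt0 normr_gt0 gt_eqF.
(* Writing v_1 = s^2, possible since v_1 > 0, makes the identity rational in s. *)
have : p (fibre 1) = Num.sqrt `|p (fibre 1)| ^+ 2.
  by rewrite sqr_sqrtr// gtr0_norm.
move: (Num.sqrt _) s0 => s s0 ->.
by field.
Qed.

(** The linear formulas at kappa = -3 with -u added to [T] and -x to [S]. The added terms contribute
    u_x^2 to D~_t S and -(kappa+1)u_x^2/2 to D~_y T, equal exactly for this kappa. *)
Lemma inhomogeneous_covering :
   is_covering [set: jetpt R] (prolongation (equation (-3)))
     (tower
        (fun p => - (u p + (u_x p ^+ 2 + u_y p) * v_1 p))
        (fun p => - (v_1 p * u_x p + x_ p))).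
Proof.
have oO : open [set: jetpt R] := openT.
apply: (equation_covering oO).
- by prove_has_act oO.
- by prove_has_act oO.
move=> p U V _; jets.
by field.
Qed.

(** At kappa = -1 the power formulas become linear in v_1 and give lambda = 1. Rescaling the v_j by
    a factor a multiplies the leading term of [S] by a^(kappa+1) relative to the rest, so here,
    unlike for other kappa, its coefficient cannot be normalised. *)
Lemma parametric_covering (lambda : R) :
   is_covering [set: jetpt R] (prolongation (equation (-1)))
     (tower
        (fun p => - ((u_y p + lambda * u_x p - lambda ^+ 2) * v_1 p))
        (fun p => - ((u_x p - lambda) * v_1 p))).
Proof.
have oO : open [set: jetpt R] := openT.
apply: (equation_covering oO).
- by prove_has_act oO.
- by prove_has_act oO.
move=> p U V _; jets.
by field.
Qed.

End Cases.

Theorem mainTheorem5 (R : realType) (kappa : R) :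
  (* 1 *)
  (kappa != -1 ->
   is_covering [set: jetpt R] (prolongation (equation kappa))
     (tower
        (fun p => (2^-1 * (kappa + 1) * u_x p ^+ 2 - u_y p) * v_1 p)
        (fun p => - (u_x p * v_1 p))))
  /\
  (* 2 *)
  (kappa != -2 -> kappa != - (3 / 2) -> kappa != -1 ->
   is_covering
     [set p : jetpt R | rpow_dom (2 * kappa + 3) (v_1 p)
                        /\ rpow_dom (kappa + 2) (v_1 p)]
     (prolongation (equation kappa))
     (tower
        (fun p => (2 * kappa + 3)^-1 * rpow (v_1 p) (2 * kappa + 3)
                  - u_x p * rpow (v_1 p) (kappa + 2)
                  + (2^-1 * (kappa + 1) * u_x p ^+ 2 - u_y p) * v_1 p)
        (fun p => (kappa + 2)^-1 * rpow (v_1 p) (kappa + 2)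
                  - u_x p * v_1 p)))
  /\
  (* 3 *)
  (kappa = -2 ->
   is_covering [set p : jetpt R | v_1 p != 0] (prolongation (equation kappa))
     (tower
        (fun p => - ((v_1 p)^-1 + u_x p
                     + (2^-1 * u_x p ^+ 2 + u_y p) * v_1 p))
        (fun p => ln `|v_1 p| - u_x p * v_1 p)))
  /\
  (* 4 *)
  (kappa = - (3 / 2) ->
   is_covering [set p : jetpt R | 0 < v_1 p] (prolongation (equation kappa))
     (tower
        (fun p => - ((4^-1 * u_x p ^+ 2 + u_y p) * v_1 p
                     + u_x p * Num.sqrt `|v_1 p| - ln `|v_1 p|))
        (fun p => 2 * Num.sqrt `|v_1 p| - u_x p * v_1 p)))
  /\
  (* 5 *)
  (kappa = -3 ->
   is_covering [set: jetpt R] (prolongation (equation kappa))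
     (tower
        (fun p => - (u p + (u_x p ^+ 2 + u_y p) * v_1 p))
        (fun p => - (v_1 p * u_x p + x_ p))))
  /\
  (* 6 *)
  (kappa = -1 -> forall lambda : R,
   is_covering [set: jetpt R] (prolongation (equation kappa))
     (tower
        (fun p => - ((u_y p + lambda * u_x p - lambda ^+ 2) * v_1 p))
        (fun p => - ((u_x p - lambda) * v_1 p)))).
Proof.
split; first by move=> _; exact: linear_covering.
split; first exact: power_covering.
split; first by move=> ->; exact: inverse_log_covering.
split; first by move=> ->; exact: sqrt_log_covering.
split; first by move=> ->; exact: inhomogeneous_covering.
by move=> -> lambda; exact: parametric_covering.
Qed.
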